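(* Let $\mathcal{L}$ be a lattice-oriented signature and let $\mathsf{K}$ be a class of $\mathcal{L}$-lattices that is closed under subalgebras and direct limits, admits regular completions, and has the superamalgamation property. Then every member of $m\mathsf{K}$ is functional.
   Context: A signature $\mathcal{L}$ is lattice-oriented if its binary symbols include distinct $\land,\lor$; an $\mathcal{L}$-lattice is an $\mathcal{L}$-algebra whose $\{\land,\lor\}$-reduct is a lattice, complete if that lattice is complete. $\mathsf{K}$ admits regular completions if for every $\mathbf{A}\in\mathsf{K}$ there is a complete $\mathbf{B}\in\mathsf{K}$ and an embedding $f\colon\mathbf{A}\to\mathbf{B}$ preserving all existing (possibly infinite) meets and joins of $\mathbf{A}$. A V-formation in $\mathsf{K}$ is a tuple $\langle\mathbf{A},\mathbf{B}_1,\mathbf{B}_2,f_1,f_2\rangle$ with $\mathbf{A},\mathbf{B}_1,\mathbf{B}_2\in\mathsf{K}$ and embeddings $f_i\colon\mathbf{A}\to\mathbf{B}_i$; a superamalgam of it in $\mathsf{K}$ is $\langle\mathbf{C},g_1,g_2\rangle$ with $\mathbf{C}\in\mathsf{K}$ and embeddings $g_i\colon\mathbf{B}_i\to\mathbf{C}$ such that $g_1\circ f_1=g_2\circ f_2$ and, whenever $b_1\in B_1$, $b_2\in B_2$, $\{i,j\}=\{1,2\}$ and $g_i(b_i)\le g_j(b_j)$, there is $a\in A$ with $g_i(b_i)\le g_i(f_i(a))=g_j(f_j(a))\le g_j(b_j)$. $\mathsf{K}$ has the superamalgamation property if every V-formation in $\mathsf{K}$ has a superamalgam in $\mathsf{K}$.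 An m-$\mathcal{L}$-lattice is $\langle\mathbf{A},\Box,\Diamond\rangle$ with $\mathbf{A}$ an $\mathcal{L}$-lattice and unary $\Box,\Diamond$ satisfying $\Box x\land x\approx\Box x$, $\Diamond x\lor x\approx \Diamond x$, $\Box(x\land y)\approx\Box x\land\Box y$, $\Diamond(x\lor y)\approx\Diamond x\lor\Diamond y$, $\Box\Diamond x\approx\Diamond x$, $\Diamond\Box x\approx\Box x$, and $\Box(\star(\Box x_1,\dots,\Box x_n))\approx\star(\Box x_1,\dots,\Box x_n)$ for every $n$-ary $\star\in\mathcal{L}$; $m\mathsf{K}$ is the class of those with $\mathbf{A}\in\mathsf{K}$. For a complete $\mathcal{L}$-lattice $\mathbf{A}$ and a set $W$, the full functional m-$\mathcal{L}$-lattice $\langle\mathbf{A}^W,\Box,\Diamond\rangle$ has pointwise $\mathcal{L}$-operations and $\Box f(u)=\bigwedge_{v\in W}f(v)$, $\Diamond f(u)=\bigvee_{v\in W}f(v)$; an m-$\mathcal{L}$-lattice is functional if it is isomorphic to a subalgebra of some full functional m-$\mathcal{L}$-lattice. *)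

(* Defs.v *)
From mathcomp Require Import all_boot all_order.
From mathcomp Require Import boolp classical_sets.

Set Implicit Arguments.
Unset Strict Implicit.
Unset Printing Implicit Defensive.

Local Open Scope classical_set_scope.

Record signature := Signature {
  symb :> Type;
  arity : symb -> nat }.

Record lattice_signature := LatticeSignature {
  lsig :> signature;
  sym_meet : lsig;
  sym_join : lsig;
  arity_meet : arity sym_meet = 2;
  arity_join : arity sym_join = 2;
  sym_meet_neq_join : sym_meet <> sym_join }.

(* As usual in universal algebra, algebras are nonempty. *)
Record algebra (L : signature) := Algebra {
  carrier :> Type;
  op : forall s : L, ('I_(arity s) -> carrier) -> carrier;
  algebra_inhabited : inhabited carrier }.

Arguments op {L} a s xs.

Section Morphisms.
Variable L : signature.

Definition is_hom (A B : algebra L) (f : A -> B) : Prop :=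
  forall (s : L) (xs : 'I_(arity s) -> A), f (op A s xs) = op B s (f \o xs).

Definition is_embedding (A B : algebra L) (f : A -> B) : Prop :=
  is_hom f /\ injective f.

Definition isomorphic (A B : algebra L) : Prop :=
  exists f : A -> B, is_hom f /\ bijective f.

Record subuniverse (A : algebra L) := Subuniverse {
  sub_set :> A -> Prop;
  sub_nonempty : exists x, sub_set x;
  sub_closed : forall (s : L) (xs : 'I_(arity s) -> A),
    (forall i, sub_set (xs i)) -> sub_set (op A s xs) }.

Lemma subalgebra_inhabited (A : algebra L) (S : subuniverse A) :
  inhabited {x : A | S x}.
Proof. by case: (sub_nonempty S) => x Sx; constructor; exists x. Qed.

Definition subalgebra (A : algebra L) (S : subuniverse A) : algebra L :=
  @Algebra L {x : A | S x}
    (fun s xs => exist _ (op A s (fun i => sval (xs i)))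
                         (sub_closed (fun i => svalP (xs i))))
    (subalgebra_inhabited S).

Definition closed_under_subalgebras (K : algebra L -> Prop) : Prop :=
  forall (A : algebra L) (S : subuniverse A), K A -> K (subalgebra S).

Local Open Scope order_scope.

Record directed_system := DirectedSystem {
  ds_disp : Order.disp_t;
  ds_index : porderType ds_disp;
  ds_nonempty : inhabited ds_index;
  ds_directed : forall i j : ds_index, exists k, i <= k /\ j <= k;
  ds_obj :> ds_index -> algebra L;
  ds_map : forall i j : ds_index, i <= j -> ds_obj i -> ds_obj j;
  ds_hom : forall i j (le_ij : i <= j), is_hom (ds_map le_ij);
  ds_id : forall i (le_ii : i <= i) x, ds_map le_ii x = x;
  ds_comp : forall i j k (le_ij : i <= j) (le_jk : j <= k) (le_ik : i <= k) x,
    ds_map le_jk (ds_map le_ij x) = ds_map le_ik x }.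

Definition is_cocone (D : directed_system) (C : algebra L)
    (g : forall i : ds_index D, D i -> C) : Prop :=
  (forall i, is_hom (g i)) /\
  (forall i j (le_ij : i <= j) x, g j (ds_map le_ij x) = g i x).

Definition is_direct_limit (D : directed_system) (C : algebra L) : Prop :=
  exists2 g : forall i : ds_index D, D i -> C, is_cocone g &
  forall (E : algebra L) (h : forall i : ds_index D, D i -> E), is_cocone h ->
    exists u : C -> E,
      [/\ is_hom u, (forall i x, u (g i x) = h i x) &
          forall v : C -> E, is_hom v -> (forall i x, v (g i x) = h i x) ->
            v =1 u].

Definition closed_under_direct_limits (K : algebra L -> Prop) : Prop :=
  forall (D : directed_system) (C : algebra L),
    (forall i, K (D i)) -> is_direct_limit D C -> K C.

End Morphisms.

Section Lattices.
Variable L : lattice_signature.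

(* The argument tuple (x, y); used at n = arity s for the binary symbols s,
   where arity s is only propositionally equal to 2. *)
Definition args2 (T : Type) (n : nat) (x y : T) : 'I_n -> T :=
  fun i => if val i == 0 then x else y.

Definition meet (A : algebra L) (x y : A) : A :=
  op A (sym_meet L) (@args2 A _ x y).

Definition join (A : algebra L) (x y : A) : A :=
  op A (sym_join L) (@args2 A _ x y).

Definition is_lattice (A : algebra L) : Prop :=
  [/\ associative (@meet A), commutative (@meet A),
      associative (@join A), commutative (@join A) &
      (forall x y : A, meet x (join x y) = x) /\
      (forall x y : A, join x (meet x y) = x)].

Definition le (A : algebra L) (x y : A) : Prop := meet x y = x.

Definition is_inf (A : algebra L) (P : set A) (x : A) : Prop :=
  (forall y, P y -> le x y) /\ (forall z, (forall y, P y -> le z y) -> le z x).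

Definition is_sup (A : algebra L) (P : set A) (x : A) : Prop :=
  (forall y, P y -> le y x) /\ (forall z, (forall y, P y -> le y z) -> le x z).

Definition complete (A : algebra L) : Prop :=
  forall P : set A, (exists x, is_inf P x) /\ (exists x, is_sup P x).

Definition big_inf (A : algebra L) (cA : complete A) (P : set A) : A :=
  sval (cid (proj1 (cA P))).

Definition big_sup (A : algebra L) (cA : complete A) (P : set A) : A :=
  sval (cid (proj2 (cA P))).

Definition preserves_existing_meets_joins (A B : algebra L) (f : A -> B) :=
  forall (P : set A) (x : A),
    (is_inf P x -> is_inf (f @` P) (f x)) /\
    (is_sup P x -> is_sup (f @` P) (f x)).

Definition admits_regular_completions (K : algebra L -> Prop) : Prop :=
  forall A, K A -> exists (B : algebra L) (f : A -> B),
    [/\ K B, complete B, is_embedding f & preserves_existing_meets_joins f].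

Definition is_superamalgam (A B1 B2 : algebra L) (f1 : A -> B1) (f2 : A -> B2)
    (C : algebra L) (g1 : B1 -> C) (g2 : B2 -> C) : Prop :=
  [/\ is_embedding g1, is_embedding g2, (forall a, g1 (f1 a) = g2 (f2 a)),
      (forall b1 b2, le (g1 b1) (g2 b2) -> exists a,
         [/\ le (g1 b1) (g1 (f1 a)), g1 (f1 a) = g2 (f2 a) &
             le (g2 (f2 a)) (g2 b2)]) &
      (forall b1 b2, le (g2 b2) (g1 b1) -> exists a,
         [/\ le (g2 b2) (g2 (f2 a)), g2 (f2 a) = g1 (f1 a) &
             le (g1 (f1 a)) (g1 b1)])].

Definition superamalgamation_property (K : algebra L -> Prop) : Prop :=
  forall (A B1 B2 : algebra L) (f1 : A -> B1) (f2 : A -> B2),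
    K A -> K B1 -> K B2 -> is_embedding f1 -> is_embedding f2 ->
    exists (C : algebra L) (g1 : B1 -> C) (g2 : B2 -> C),
      K C /\ is_superamalgam f1 f2 g1 g2.

End Lattices.

Inductive msymb (L : signature) : Type :=
  | MBase of symb L
  | MBox
  | MDia.

Arguments MBox {L}.
Arguments MDia {L}.

Definition msig (L : signature) : signature :=
  @Signature (msymb L)
    (fun s => match s with MBase t => arity t | MBox => 1 | MDia => 1 end).

Definition reduct (L : signature) (M : algebra (msig L)) : algebra L :=
  @Algebra L M (fun s xs => op M (MBase s) xs) (algebra_inhabited M).

Section MLattices.
Variable L : lattice_signature.

Definition box (M : algebra (msig L)) (x : reduct M) : reduct M :=
  op M MBox (fun=> x).

Definition dia (M : algebra (msig L)) (x : reduct M) : reduct M :=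
  op M MDia (fun=> x).

Record is_mlattice (M : algebra (msig L)) : Prop := IsMLattice {
  mlattice_lattice : is_lattice (reduct M);
  box_meet_id : forall x : reduct M, meet (box x) x = box x;
  dia_join_id : forall x : reduct M, join (dia x) x = dia x;
  box_meet : forall x y : reduct M, box (meet x y) = meet (box x) (box y);
  dia_join : forall x y : reduct M, dia (join x y) = join (dia x) (dia y);
  box_dia : forall x : reduct M, box (dia x) = dia x;
  dia_box : forall x : reduct M, dia (box x) = box x;
  box_op : forall (s : L) (xs : 'I_(arity s) -> reduct M),
    box (op (reduct M) s (fun i => box (xs i))) =
    op (reduct M) s (fun i => box (xs i)) }.

Definition mclass (K : algebra L -> Prop) (M : algebra (msig L)) : Prop :=
  is_mlattice M /\ K (reduct M).

Lemma power_inhabited (A : algebra L) (W : Type) : inhabited (W -> A).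
Proof. by case: (algebra_inhabited A) => a; constructor=> _; exact: a. Qed.

Definition full_functional (A : algebra L) (cA : complete A) (W : Type) :
    algebra (msig L) :=
  @Algebra (msig L) (W -> A)
    (fun s => match s with
      | MBase t => fun fs u => op A t (fun i => fs i u)
      | MBox => fun fs _ => big_inf cA (range (fs ord0))
      | MDia => fun fs _ => big_sup cA (range (fs ord0))
      end)
    (power_inhabited A W).

Definition functional (M : algebra (msig L)) : Prop :=
  exists (A : algebra L) (cA : complete A) (W : Type)
         (S : subuniverse (full_functional cA W)),
    is_lattice A /\ isomorphic M (subalgebra S).

End MLattices.

(* Main.v *)
From mathcomp Require Import all_boot all_order.
From mathcomp Require Import boolp classical_sets.
Require Import Defs.

(** Let [A0] be the subalgebra of box-fixed elements of the [L]-reduct [A] of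
    the given algebra. Starting from [A], amalgamate repeatedly with [A] over
    [A0]: this gives a chain [C 0 -> C 1 -> ...] with a copy of [A] in each
    [C n.+1] that is superamalgamated with [C n] over [A0]. In the direct limit,
    [box x] is the meet of the copies of [x]: a lower bound already lives in
    some [C n], so an element [a] of [A0] separates it from the [n]-th copy of
    [x], whence [a <= x] and [a = box a <= box x]. Dually for [dia]. A regular
    completion of the limit keeps these meets and joins, so that sending [x] to
    the sequence of its copies is the required embedding. *)

Set Implicit Arguments.
Unset Strict Implicit.
Unset Printing Implicit Defensive.

Import Order.TTheory.
Local Open Scope classical_set_scope.

(** * Homomorphisms, embeddings and their images *)

Section Homomorphisms.
Variable L : signature.

Lemma is_hom_comp (A B C : algebra L) (f : A -> B) (g : B -> C) :
  is_hom f -> is_hom g -> is_hom (g \o f).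
Proof. by move=> hf hg s xs /=; rewrite hf hg. Qed.

Lemma is_embedding_comp (A B C : algebra L) (f : A -> B) (g : B -> C) :
  is_embedding f -> is_embedding g -> is_embedding (g \o f).
Proof.
by case=> hf jf [hg jg]; split; [exact: is_hom_comp | exact: inj_comp].
Qed.

Lemma sval_embedding (A : algebra L) (S : subuniverse A) :
  is_embedding (sval : subalgebra S -> A).
Proof. by split=> // x y; exact: eq_sig_hprop. Qed.

Lemma embedding_isomorphic_image (A B : algebra L) (f : A -> B) :
  is_embedding f -> exists S : subuniverse B, isomorphic A (subalgebra S).
Proof.
case=> hf jf.
have ne : exists y, range f y.
  by case: (algebra_inhabited A) => x; exists (f x), x.
have clos (s : L) (ys : 'I_(arity s) -> B) :
    (forall i, range f (ys i)) -> range f (op B s ys).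
  move=> fys; have /choice [xs xsE] i : exists x, f x = ys i.
    by case: (fys i) => x _ <-; exists x.
  exists (op A s xs) => //; rewrite hf; congr op.
  exact: funext.
exists (Subuniverse ne clos).
have fr x : range f (f x) by exists x.
exists (fun x => exist _ (f x) (fr x)); split.
  by move=> s xs; apply: eq_sig_hprop => //=; rewrite hf.
(* A total left inverse of [f], chosen classically; its values off the range are arbitrary. *)
have /choice [g gK] y : exists x, range f y -> f x = y.
  have [[x _ <-]|nfy] := pselect (range f y).
    by exists x.
  by case: (algebra_inhabited A) => x; exists x.
exists (fun y => g (sval y)) => [x|[y fy]] /=.
  by apply: jf; apply: gK.
by apply: eq_sig_hprop => //=; rewrite gK.
Qed.

End Homomorphisms.

(** * Construction of direct limits of algebras *)

Section DirectLimits.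
Variables (L : signature) (D : directed_system L).
Local Open Scope order_scope.
Let I := ds_index D.
Local Notation staged x := (Tagged (fun i => carrier (D i)) x).

Lemma directed_bound (n : nat) (f : 'I_n -> I) : exists k, forall i, f i <= k.
Proof.
elim: n f => [|n IHn] f; first by case: (ds_nonempty D) => k; exists k; case.
have [k fk] := IHn (fun i => f (lift ord0 i)).
have [m [km fm]] := ds_directed k (f ord0).
exists m => i; case: (unliftP ord0 i) => [j ->|-> //].
exact: le_trans (fk j) km.
Qed.

Definition germ_eq (x y : {i : I & D i}) : Prop :=
  exists (k : I) (xk : tag x <= k) (yk : tag y <= k),
    ds_map xk (tagged x) = ds_map yk (tagged y).

Lemma germ_eq_refl x : germ_eq x x.
Proof. by exists (tag x), (lexx _), (lexx _). Qed.

Lemma germ_eq_sym x y : germ_eq x y -> germ_eq y x.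
Proof. by case=> k [xk [yk e]]; exists k, yk, xk. Qed.

Lemma germ_eq_trans x y z : germ_eq x y -> germ_eq y z -> germ_eq x z.
Proof.
move=> [k [xk [yk e]]] [l [yl [zl e']]].
have [m [km lm]] := ds_directed k l.
exists m, (le_trans xk km), (le_trans zl lm).
rewrite -(ds_comp xk km) e (ds_comp _ _ (le_trans yk km)).
by rewrite -(ds_comp zl lm) -e' (ds_comp _ _ (le_trans yk km)).
Qed.

(** The quotient is realised by the equivalence classes themselves, so equality of germs reduces to
    extensional equality of predicates. *)
Definition germ : Type := {P : set {i : I & D i} | exists x, P = germ_eq x}.

Definition to_germ (i : I) (x : D i) : germ :=
  exist _ (germ_eq (staged x)) (ex_intro _ (staged x) erefl).

Lemma to_germ_surj (c : germ) :
  exists x : {i : I & D i}, to_germ (tagged x) = c.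
Proof.
by case: c => P [[i x] Px]; exists (staged x); exact: eq_sig_hprop.
Qed.

Definition germ_repr (c : germ) : {i : I & D i} := sval (cid (to_germ_surj c)).

Lemma germ_reprK c : to_germ (tagged (germ_repr c)) = c.
Proof. exact: svalP (cid (to_germ_surj c)). Qed.

Lemma to_germ_eq (i j : I) (x : D i) (y : D j) :
  to_germ x = to_germ y <-> germ_eq (staged x) (staged y).
Proof.
split=> [[e]|e]; first by rewrite e; exact: germ_eq_refl.
apply: eq_sig_hprop => //=; apply/funext => z; apply/propext; split.
  exact/germ_eq_trans/germ_eq_sym.
exact: germ_eq_trans.
Qed.

Lemma germ_repr_to_germ (i : I) (x : D i) :
  germ_eq (germ_repr (to_germ x)) (staged x).
Proof.
by rewrite -[germ_repr _]taggedK; apply/to_germ_eq; exact: germ_reprK.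
Qed.

Lemma to_germ_map (i j : I) (ij : i <= j) (x : D i) :
  to_germ (ds_map ij x) = to_germ x.
Proof.
by apply/to_germ_eq; exists j, (lexx j), ij; rewrite /= ds_id.
Qed.

Lemma to_germ_inj (i : I) :
  (forall j (ij : i <= j), injective (ds_map ij)) -> injective (@to_germ i).
Proof.
move=> inj x y /to_germ_eq [k [/= ik [ik']]].
(* The two transition maps differ only in their proofs of [i <= k]. *)
by rewrite (Prop_irrelevance ik' ik) => /inj.
Qed.

Lemma germ_repr_bound (n : nat) (cs : 'I_n -> germ) :
  exists k, forall i, tag (germ_repr (cs i)) <= k.
Proof. exact: (directed_bound (fun i => tag (germ_repr (cs i)))). Qed.

Lemma germ_inhabited : inhabited germ.
Proof.
case: (ds_nonempty D) => i; case: (algebra_inhabited (D i)) => x.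
by constructor; exact: (to_germ x).
Qed.

(** Arities are finite, so the chosen representatives of the arguments can be moved to a common
    stage [k] and the operation evaluated there. *)
Definition direct_limit : algebra L :=
  @Algebra L germ
    (fun s cs => let k := cid (germ_repr_bound cs) in
       to_germ (op (D (sval k)) s
         (fun i => ds_map (svalP k i) (tagged (germ_repr (cs i))))))
    germ_inhabited.

(** The choices made in [direct_limit] do not matter: two evaluations agree at any late enough
    stage. *)
Lemma to_germ_hom (i : I) : is_hom (@to_germ i : D i -> direct_limit).
Proof.
move=> s xs; rewrite /=; case: (cid _) => k /= ck.
(* At stage [l a] the chosen representative of the [a]-th argument meets [xs a]; the stage [m] below
   lies above all [l a], [k] and [i]. *)
have [l lP] := choice (fun a => germ_repr_to_germ (xs a)).
have [m0 lm0] := directed_bound l.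
have [m1 [m01 km1]] := ds_directed m0 k.
have [m [m1m im]] := ds_directed m1 i.
have km := le_trans km1 m1m.
rewrite -(to_germ_map im) -(to_germ_map km) !ds_hom; congr to_germ; congr op.
apply/funext => a /=; have [ra [ia e]] := lP a.
have lm : l a <= m by rewrite (le_trans (lm0 a)) // (le_trans m01).
rewrite (ds_comp _ _ (le_trans ra lm)) -(ds_comp ra lm) e.
by rewrite (ds_comp _ _ im).
Qed.

Lemma direct_limitP : is_direct_limit D direct_limit.
Proof.
exists (fun i => @to_germ i); first split.
- exact: to_germ_hom.
- exact: to_germ_map.
move=> E h [hom_h hmap].
have uE i (x : D i) : h _ (tagged (germ_repr (to_germ x))) = h i x.
  (* The mediating map applies [h] to the chosen representative; compatibility of [h] makes the
     choice irrelevant. *)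
  by have [k [rk [ik e]]] := germ_repr_to_germ x; rewrite -(hmap _ _ rk) e hmap.
exists (fun c => h _ (tagged (germ_repr c))); split=> //.
- move=> s cs; rewrite {1}/op /=; case: (cid _) => k /= ck.
  rewrite uE hom_h; congr op; apply/funext => a /=.
  by rewrite hmap.
- by move=> v _ vE c; rewrite -{1}(germ_reprK c) vE.
Qed.

End DirectLimits.

(** * Chains of embeddings and their limits *)

Section Chains.
Variable L : signature.
Implicit Type C : nat -> algebra L.

(* Recursion on both indices, shifting the chain, avoids transport along
   equalities between natural numbers. *)
Fixpoint chain_map C (step : forall n, C n -> C n.+1) (i j : nat) :
    (i <= j)%N -> C i -> C j :=
  match i, j return (i <= j)%N -> C i -> C j with
  | 0, 0 => fun _ x => x
  | 0, j'.+1 => fun _ x => step j' (chain_map step (leq0n j') x)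
  | _.+1, 0 => fun lt0 _ => False_rect _ (notF lt0)
  | i'.+1, j'.+1 => fun ij x =>
      @chain_map (fun n => C n.+1) (fun n => @step n.+1) i' j' ij x
  end.

Lemma chain_map_id C step i (ii : (i <= i)%N) x :
  @chain_map C step i i ii x = x.
Proof. by elim: i C step ii x => //= i IHi C step ii x; rewrite IHi. Qed.

Lemma chain_mapS C step i j (ij : (i <= j)%N) (ij1 : (i <= j.+1)%N) x :
  @chain_map C step i j.+1 ij1 x = step j (chain_map step ij x).
Proof.
elim: i j C step ij ij1 x => [|i IHi] [|j] C step ij ij1 x //=.
exact: (IHi j (fun n => C n.+1) (fun n => @step n.+1) ij).
Qed.

(** Induction on the last index: either the second map is an identity, or both sides end with the
    same step. *)
Lemma chain_map_comp C step i j k (ij : (i <= j)%N) (jk : (j <= k)%N)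
    (ik : (i <= k)%N) x :
  chain_map step jk (@chain_map C step i j ij x) = chain_map step ik x.
Proof.
elim: k jk ik => [|k IHk] jk ik.
  have /eqP j0 : j == 0 by rewrite -leqn0.
  subst j.
  by rewrite chain_map_id (Prop_irrelevance ik ij).
have /predU1P[jk1|jk1] : (j == k.+1) || (j <= k)%N
    by rewrite -ltnS -leq_eqVlt.
  by subst j; rewrite chain_map_id (Prop_irrelevance ik ij).
have ik1 := leq_trans ij jk1.
by rewrite (chain_mapS step jk1) (chain_mapS step ik1) IHk.
Qed.

Lemma chain_map_embedding C step i j (ij : (i <= j)%N) :
  (forall n, is_embedding (step n)) -> is_embedding (@chain_map C step i j ij).
Proof.
move=> emb; elim: j ij => [|j IHj] ij.
  have /eqP i0 : i == 0 by rewrite -leqn0.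
  subst i.
  by split=> [s xs|x y]; rewrite /= ?chain_map_id.
have /predU1P[ij1|ij1] : (i == j.+1) || (i <= j)%N
    by rewrite -ltnS -leq_eqVlt.
  subst i; split=> [s xs|x y]; rewrite !chain_map_id //.
  by congr op; apply/funext => a /=; rewrite chain_map_id.
have -> : chain_map step ij = step j \o chain_map step (ij1 : (i <= j)%N).
  by apply/funext => x; rewrite (chain_mapS step ij1).
exact: is_embedding_comp.
Qed.

Lemma nat_directed (i j : nat) : exists k : nat, (i <= k)%O /\ (j <= k)%O.
Proof. by exists (maxn i j); rewrite !leEnat leq_maxl leq_maxr. Qed.

Definition chain C (step : forall n, C n -> C n.+1)
    (emb : forall n, is_embedding (step n)) : directed_system L :=
  @DirectedSystem L _ nat (inhabits 0) nat_directed C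
    (fun i j ij => @chain_map C step i j ij)
    (fun i j ij => proj1 (@chain_map_embedding C step i j ij emb))
    (@chain_map_id C step) (@chain_map_comp C step).

(** All that is needed later about the limit. The first clause serves to transfer membership in a
    class from the [C n] to [E]. *)
Lemma chain_limit C (step : forall n, C n -> C n.+1) :
  (forall n, is_embedding (step n)) ->
  exists (D : directed_system L) (E : algebra L) (g : forall n, C n -> E),
    [/\ (forall i, exists n, D i = C n) /\ is_direct_limit D E,
        forall n, is_embedding (g n),
        forall n x, g n.+1 (step n x) = g n x &
        forall z, exists n x, g n x = z].
Proof.
move=> emb; pose D := chain emb.
exists D, (direct_limit D), (fun n => @to_germ L D n); split.
- by split; [move=> i; exists i | exact: direct_limitP].
- move=> n; split; first exact: (@to_germ_hom L D n).
  by apply: to_germ_inj => j nj; case: (chain_map_embedding nj emb).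
- move=> n x; rewrite -{1}(chain_map_id step (leqnn n) x).
  rewrite -(chain_mapS step (leqnn n) (leqnSn n)).
  exact: (@to_germ_map L D n n.+1).
- by move=> z; case: (to_germ_surj z) => -[n x] /= <-; exists n, x.
Qed.

End Chains.

(** * The lattice order, infima and suprema *)

Section LatticeOrder.
Variable L : lattice_signature.
Implicit Types A B C : algebra L.

Lemma op_args2 A B (f : A -> B) n (x y : A) :
  f \o @args2 A n x y = @args2 B n (f x) (f y).
Proof. by apply/funext => i; rewrite /args2 /=; case: ifP. Qed.

Lemma hom_meet A B (f : A -> B) x y :
  is_hom f -> f (meet x y) = meet (f x) (f y).
Proof. by move=> hf; rewrite /meet hf op_args2. Qed.

Lemma le_hom A B (f : A -> B) x y : is_hom f -> le x y -> le (f x) (f y).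
Proof. by move=> hf; rewrite /le -hom_meet // => ->. Qed.

Lemma le_emb A B (f : A -> B) x y : is_embedding f -> le (f x) (f y) -> le x y.
Proof. by case=> hf jf; rewrite /le -hom_meet // => /jf. Qed.

Lemma lattice_le_trans A (x y z : A) :
  is_lattice A -> le x y -> le y z -> le x z.
Proof. by case=> mA _ _ _ _; rewrite /le => xy yz; rewrite -xy -mA yz. Qed.

Lemma lattice_le_antisym A (x y : A) :
  is_lattice A -> le x y -> le y x -> x = y.
Proof. by case=> _ mC _ _ _; rewrite /le => xy yx; rewrite -xy mC yx. Qed.

Lemma lattice_le_join A (x y : A) : is_lattice A -> le x y <-> join x y = y.
Proof.
case=> _ mC _ jC [mj jm]; rewrite /le; split=> <-.
  by rewrite jC mC jm.
exact: mj.
Qed.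

Lemma is_inf_unique A (P : set A) x y :
  is_lattice A -> is_inf P x -> is_inf P y -> x = y.
Proof. by move=> lA [xl xg] [yl yg]; apply: lattice_le_antisym; auto. Qed.

Lemma is_sup_unique A (P : set A) x y :
  is_lattice A -> is_sup P x -> is_sup P y -> x = y.
Proof. by move=> lA [xl xg] [yl yg]; apply: lattice_le_antisym; auto. Qed.

Lemma big_infE A (cA : complete A) (P : set A) x :
  is_lattice A -> is_inf P x -> big_inf cA P = x.
Proof. by move=> lA; apply: is_inf_unique => //; exact: svalP (cid _). Qed.

Lemma big_supE A (cA : complete A) (P : set A) x :
  is_lattice A -> is_sup P x -> big_sup cA P = x.
Proof. by move=> lA; apply: is_sup_unique => //; exact: svalP (cid _). Qed.

End LatticeOrder.

(** * The subalgebra of box-fixed elements *)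

Section BoxFixed.
Variables (L : lattice_signature) (M : algebra (msig L)).
Hypothesis mM : is_mlattice M.
Implicit Types x y a : reduct M.

Definition box_fixed a : Prop := box a = a.

(** Since [box x = dia (box x)], the identity [box_dia] applies. *)
Lemma box_fixed_box x : box_fixed (box x).
Proof.
by rewrite /box_fixed -[in LHS](dia_box mM x) (box_dia mM) (dia_box mM).
Qed.

Lemma box_fixed_dia x : box_fixed (dia x).
Proof. exact: box_dia mM _. Qed.

Lemma dia_fixed a : box_fixed a -> dia a = a.
Proof. by move=> <-; exact: dia_box mM _. Qed.

Lemma box_fixed_nonempty : exists a, box_fixed a.
Proof.
case: (algebra_inhabited M) => x.
by exists (box (x : reduct M)); exact: box_fixed_box.
Qed.

Lemma box_fixed_op (s : L) (xs : 'I_(arity s) -> reduct M) :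
  (forall i, box_fixed (xs i)) -> box_fixed (op (reduct M) s xs).
Proof.
move=> bxs; have -> : xs = fun i => box (xs i).
  by apply/funext => i; exact/esym/bxs.
exact: box_op mM _ _.
Qed.

Definition box_subuniverse : subuniverse (reduct M) :=
  Subuniverse box_fixed_nonempty box_fixed_op.

Lemma box_le x : le (box x) x.
Proof. exact: box_meet_id mM x. Qed.

Lemma dia_ge x : le x (dia x).
Proof.
apply/(lattice_le_join _ _ (mlattice_lattice mM)).
case: (mlattice_lattice mM) => _ _ _ jC _; rewrite jC.
exact: dia_join_id mM x.
Qed.

(** Monotonicity of [box], a consequence of its preserving meets, applied to [a = box a]. *)
Lemma box_greatest a x : box_fixed a -> le a x -> le a (box x).
Proof. by move=> ba ax; rewrite /le -{1}ba -(Defs.box_meet mM) ax. Qed.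

Lemma dia_least a x : box_fixed a -> le x a -> le (dia x) a.
Proof.
have lM := mlattice_lattice mM; move=> ba /(lattice_le_join _ _ lM) xa.
apply/(lattice_le_join _ _ lM).
by rewrite -{1}(dia_fixed ba) -(dia_join mM) xa dia_fixed.
Qed.

End BoxFixed.

(** * Iterated superamalgamation over a fixed algebra *)

Section SuperamalgamChain.
Variables (L : lattice_signature) (K : algebra L -> Prop).
Hypothesis K_sap : superamalgamation_property K.
Variables (A0 A : algebra L) (f : A0 -> A).
Hypotheses (KA0 : K A0) (KA : K A) (f_emb : is_embedding f).

(** A stage carries its embedding of [A0] and its membership in [K], so that amalgamation can be
    iterated as a function on stages. *)
Record extension := Extension {
  ext_obj :> algebra L;
  ext_map : A0 -> ext_obj;
  ext_K : K ext_obj;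
  ext_emb : is_embedding ext_map }.

Lemma superamalgam_extension (C : extension) :
  exists (C' : extension) (p : (C -> C') * (A -> C')),
    is_superamalgam (@ext_map C) f p.1 p.2 /\
    @ext_map C' = p.1 \o @ext_map C.
Proof.
have [C' [g1 [g2 [KC' sup]]]] :=
  K_sap KA0 (ext_K C) KA (ext_emb C) f_emb.
have g1e : is_embedding g1 by case: sup.
by exists (Extension KC' (is_embedding_comp (ext_emb C) g1e)), (g1, g2).
Qed.

Lemma superamalgam_chain : exists (C : nat -> extension)
    (step : forall n, C n -> C n.+1) (g : forall n, A -> C n.+1),
  forall n, is_superamalgam (@ext_map (C n)) f (step n) (g n) /\
    @ext_map (C n.+1) = step n \o @ext_map (C n).
Proof.
pose next C := sval (cid (superamalgam_extension C)).
have nextP (C : extension) := svalP (cid (superamalgam_extension C)).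
pose C n := iter n next (Extension KA f_emb).
exists C, (fun n => (sval (cid (nextP (C n)))).1).
exists (fun n => (sval (cid (nextP (C n)))).2) => n.
exact: svalP (cid (nextP (C n))).
Qed.

End SuperamalgamChain.

(** * Copies of the reduct realising [box] and [dia] as bounds *)

Section CopiesWithExtremalBounds.
Variables (L : lattice_signature) (K : algebra L -> Prop).
Hypothesis K_lattices : forall A : algebra L, K A -> is_lattice A.
Hypothesis K_sub : closed_under_subalgebras K.
Hypothesis K_lim : closed_under_direct_limits K.
Hypothesis K_sap : superamalgamation_property K.
Variable M : algebra (msig L).
Hypothesis MK : mclass K M.

(** The bounds are stated with copy 0, but by the last clause any copy would do, as all copies agree
    on box-fixed elements. *)
Lemma mclass_copies : exists (E : algebra L) (g : nat -> reduct M -> E),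
  [/\ K E, forall n, is_embedding (g n),
      forall x, is_inf (range (fun n => g n x)) (g 0 (box x)) &
      forall x, is_sup (range (fun n => g n x)) (g 0 (dia x))] /\
  forall n a, box_fixed a -> g n a = g 0 a.
Proof.
have [mM KM] := MK.
have KA0 : K (subalgebra (box_subuniverse mM)) by exact: K_sub.
have [C [step [c cP]]] := superamalgam_chain K_sap KA0 KM (sval_embedding _).
have emb n : is_embedding (step n) by case: (cP n) => -[].
have [D [E [e [[DC limE] e_emb eS e_surj]]]] := chain_limit emb.
have KE : K E.
  by apply: K_lim limE => i; have [n ->] := DC i; exact: ext_K.
have lE := K_lattices KE.
pose g n := e n.+1 \o c n.
have g_emb n : is_embedding (g n).
  by apply: is_embedding_comp; [case: (cP n) => -[] | exact: e_emb].
(* The amalgam commutes over [A0], so copy [n] restricted to [A0] factors through stage [n]. *)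
have ge n a : e n (ext_map (C n) a) = g n (sval a).
  by case: (cP n) => -[_ _ ca _ _] _; rewrite /g /= -ca eS.
have eE n a : e n (ext_map (C n) a) = e 0 (ext_map (C 0) a).
  by elim: n => // n <-; case: (cP n) => _ -> /=; rewrite eS.
have gE n a : box_fixed a -> g n a = g 0 a.
  move=> ba; pose a' : subalgebra (box_subuniverse mM) := exist _ a ba.
  by rewrite -[a]/(sval a') -!ge eE.
exists E, g; split=> //; split=> // x; split.
- move=> _ [n _ <-]; rewrite -(gE n); last exact: box_fixed_box.
  by apply: le_hom (box_le mM x); case: (g_emb n).
(* A lower bound from stage [n] is compared with copy [n], which is the one superamalgamated with
   that stage. *)
- move=> z zx; have [n [y yz]] := e_surj z.
  have : le (step n y) (c n x).
    by apply: (le_emb (e_emb n.+1)); rewrite eS yz; apply: zx; exists n.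
  case: (cP n) => -[_ cn_emb _ sep _] _ /sep [a [ya ac cx]].
  have ax : le (sval a) (box x).
    by apply: box_greatest (svalP a) _ => //; exact: le_emb cx.
  rewrite -(gE n); last exact: box_fixed_box.
  (* The interpolant gives [z <= g n a <= g n (box x)]. *)
  apply: (@lattice_le_trans _ _ _ (g n (sval a))) => //.
    by rewrite /g /= -ac -yz -(eS n y); apply: le_hom ya; case: (e_emb n.+1).
  by apply: le_hom ax; case: (g_emb n).
- move=> _ [n _ <-]; rewrite -(gE n); last exact: box_fixed_dia.
  by apply: le_hom (dia_ge mM x); case: (g_emb n).
- move=> z zx; have [n [y yz]] := e_surj z.
  have : le (c n x) (step n y).
    by apply: (le_emb (e_emb n.+1)); rewrite eS yz; apply: zx; exists n.
  case: (cP n) => -[_ cn_emb _ _ sep] _ /sep [a [xa ca ay]].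
  have ax : le (dia x) (sval a).
    by apply: dia_least (svalP a) _ => //; exact: le_emb xa.
  rewrite -(gE n); last exact: box_fixed_dia.
  apply: (@lattice_le_trans _ _ _ (g n (sval a))) => //.
    by apply: le_hom ax; case: (g_emb n).
  by rewrite /g /= ca -yz -(eS n y); apply: le_hom ay; case: (e_emb n.+1).
Qed.

End CopiesWithExtremalBounds.

(** * Embedding into a full functional algebra over [nat] *)

Theorem theorem4p1 (L : lattice_signature) (K : algebra L -> Prop)
  (K_lattices : forall A : algebra L, K A -> is_lattice A)
  (K_sub : closed_under_subalgebras K)
  (K_lim : closed_under_direct_limits K)
  (K_reg : admits_regular_completions K)
  (K_sap : superamalgamation_property K) :
  forall M : algebra (msig L), mclass K M -> functional M.
Proof.
move=> M MK; have [mM _] := MK.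
have [E [g [[KE g_emb g_inf g_sup] gE]]] :=
  mclass_copies K_lattices K_sub K_lim K_sap MK.
have [B [h [KB cB h_emb h_reg]]] := K_reg _ KE.
have lB := K_lattices _ KB.
pose F (x : M) : full_functional cB nat := fun n => h (g n x).
have hg_range x : h @` range (fun n => g n x) = range (F x).
  by rewrite image_comp.
have F_emb : is_embedding F.
  split=> [|x y xy]; last first.
    (* Coordinate 0 alone already separates points. *)
    apply: (proj2 (g_emb 0)); apply: (proj2 h_emb (g 0 x) (g 0 y)).
    exact: (congr1 (fun G : nat -> B => G 0) xy).
  case=> [s||] xs; apply/funext => n; rewrite /F /=.
  - by rewrite (proj1 (g_emb n)) (proj1 h_emb).
  - have -> : op M MBox xs = box (xs ord0 : reduct M).
      by congr op; apply/funext => i; rewrite ord1.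
    (* The sequence of copies of a box is constant, and regularity of [h] makes its value the meet
       of the range of [F (xs ord0)] in [B]. *)
    rewrite gE; last exact: box_fixed_box.
    apply/esym/big_infE => //.
    by have := proj1 (h_reg _ _) (g_inf (xs ord0)); rewrite hg_range.
  - have -> : op M MDia xs = dia (xs ord0 : reduct M).
      by congr op; apply/funext => i; rewrite ord1.
    rewrite gE; last exact: box_fixed_dia.
    apply/esym/big_supE => //.
    by have := proj2 (h_reg _ _) (g_sup (xs ord0)); rewrite hg_range.
have [S MS] := embedding_isomorphic_image F_emb.
by exists B, cB, nat, S.
Qed.
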